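(* Let $f:\mathbb R^n\to(-\infty,+\infty]$ and $g:\mathbb R^m\to(-\infty,+\infty]$ be proper lower semicontinuous convex functions, let $A\in\mathbb R^{m\times n}$, and assume that the set $\mathcal Z^*$ of optimal solutions of $\min_{x\in\mathbb R^n}\max_{y\in\mathbb R^m} f(x)+\langle Ax,y\rangle-g(y)$ is nonempty. Let $0<s<\frac1{\|A\|}$ and let $\{z_k\}_{k=0}^\infty$, $z_k=(x_k,y_k)$, be the iterates of PDHG with step-size $s$ started at some $z_0\in\mathbb R^n\times\mathbb R^m$. Suppose that there are a constant $\alpha_s>0$ and a set $\mathbb S\subseteq\mathbb R^{n+m}$ containing $\{z_k\}_{k=0}^\infty$ such that $$\alpha_s\,\mathrm{dist}_{P_s}(z,\mathcal Z^* )\le \mathrm{dist}_{P_s^{-1}}(0,\mathcal F(z))\qquad\text{for all } z\in\mathbb S .$$ Then for every $k\ge\lceil e/\alpha_s^2\rceil$, $$\mathrm{dist}_{P_s^{-1}}^2(0,\mathcal F(z_k))\le\exp\left(1-\frac{k}{\lceil e/\alpha_s^2\rceil}\right)\mathrm{dist}_{P_s^{-1}}^2(0,\mathcal F(z_0)).$$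
   Context: $\|A\|$ is the operator (spectral) norm, with $1/\|A\|=+\infty$ if $A=0$; $e$ is Euler's number. For $\tau>0$ and convex $h$, $\mathrm{prox}_h^{\tau}(x)=\mathrm{argmin}_{u}\{h(u)+\frac1{2\tau}\|u-x\|_2^2\}$. PDHG (primal-dual hybrid gradient) with step-size $s>0$ is the iteration $$x_{k+1}=\mathrm{prox}_f^{s}(x_k-sA^Ty_k),\qquad y_{k+1}=\mathrm{prox}_g^{s}(y_k+sA(2x_{k+1}-x_k)).$$ For $z=(x,y)$, $\mathcal F(z)=\begin{pmatrix}\partial f(x)+A^Ty\\ -Ax+\partial g(y)\end{pmatrix}\subseteq\mathbb R^{n+m}$, where $\partial$ is the convex subdifferential. $\mathcal Z^*=\{z:0\in\mathcal F(z)\}$ (equivalently, the set of saddle points). $P_s=\begin{pmatrix}\frac1sI_n&-A^T\\-A&\frac1sI_m\end{pmatrix}$, which is positive definite for $0<s<1/\|A\|$. For positive definite $M$, $\|u\|_M=\sqrt{u^TMu}$ and $\mathrm{dist}_M(z,\mathcal S)=\inf_{u\in\mathcal S}\|u-z\|_M$ (equal to $+\infty$ if $\mathcal S=\emptyset$). *)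

(* Defs.v *)
From mathcomp Require Import all_boot all_order all_algebra.
From mathcomp Require Import all_classical all_reals all_analysis.

Set Implicit Arguments.
Unset Strict Implicit.
Unset Printing Implicit Defensive.

Import Order.TTheory GRing.Theory Num.Theory.
Import numFieldNormedType.Exports.

Local Open Scope classical_set_scope.
Local Open Scope ring_scope.

Section euclidean.
Context {R : realType}.

Definition dotp (n : nat) (u v : 'cV[R]_n) : R := (u^T *m v) 0 0.

(* The norm `|_| of MathComp-Analysis on matrices is the max norm, hence a
   separate Euclidean norm. *)
Definition norm2 (n : nat) (u : 'cV[R]_n) : R := Num.sqrt (dotp u u).

(* Operator norm induced by the Euclidean norms. *)
Definition opnorm (m n : nat) (A : 'M[R]_(m, n)) : R :=
  sup [set norm2 (A *m x) | x in [set x : 'cV[R]_n | norm2 x <= 1]].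

(* Meaningful for positive definite M only. *)
Definition normM (p : nat) (M : 'M[R]_p) (u : 'cV[R]_p) : R :=
  Num.sqrt (dotp u (M *m u)).

(* Extended-real valued: the distance to set0 is +oo. *)
Definition distM (p : nat) (M : 'M[R]_p) (z : 'cV[R]_p) (S : set 'cV[R]_p) :
    \bar R :=
  ereal_inf [set (normM M (u - z))%:E | u in S].

End euclidean.

Section convex_analysis.
Context {R : realType}.
Local Open Scope ereal_scope.

Definition proper_fct (n : nat) (h : 'cV[R]_n -> \bar R) : Prop :=
  (forall x, h x != -oo) /\ (exists x, h x < +oo).

(* The library's convex_function only covers real-valued functions. No
   indeterminate sum occurs for functions that avoid -oo, and the endpoints
   t = 0, 1 are harmless because 0 * +oo = 0. *)
Definition econvex (n : nat) (h : 'cV[R]_n -> \bar R) : Prop :=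
  forall (x y : 'cV[R]_n) (t : R), (0 <= t <= 1)%R ->
    h (t *: x + (1 - t) *: y)%R <= t%:E * h x + (1 - t)%:E * h y.

Definition subdiff (n : nat) (h : 'cV[R]_n -> \bar R) (x : 'cV[R]_n) :
    set 'cV[R]_n :=
  [set v | forall w, h x + (dotp v (w - x)%R)%:E <= h w].

Definition argmin (T : Type) (F : T -> \bar R) : set T :=
  [set u | forall w, F u <= F w].

(* Set-valued; a singleton when h is proper, convex and lower semicontinuous. *)
Definition prox (n : nat) (h : 'cV[R]_n -> \bar R) (tau : R) (x : 'cV[R]_n) :
    set 'cV[R]_n :=
  argmin (fun u => h u + ((2 * tau)^-1 * norm2 (u - x)%R ^+ 2)%R%:E).

End convex_analysis.

Section pdhg.
Context {R : realType} (n m : nat).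
Variables (f : 'cV[R]_n -> \bar R) (g : 'cV[R]_m -> \bar R).
Variable A : 'M[R]_(m, n).

(* z = (x, y) is encoded as col_mx x y, so x = usubmx z and y = dsubmx z. *)
Definition KKT (z : 'cV[R]_(n + m)) : set 'cV[R]_(n + m) :=
  [set w | exists u v, [/\ subdiff f (usubmx z) u, subdiff g (dsubmx z) v &
     w = col_mx (u + A^T *m dsubmx z) (- (A *m usubmx z) + v)]].

Definition Zstar : set 'cV[R]_(n + m) := [set z | KKT z 0].

Definition Pmx (s : R) : 'M[R]_(n + m) :=
  block_mx (s^-1)%:M (- A^T) (- A) (s^-1)%:M.

Definition is_PDHG (s : R) (z : nat -> 'cV[R]_(n + m)) : Prop :=
  forall k : nat,
    let x := usubmx (z k) in let y := dsubmx (z k) in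
    let x' := usubmx (z k.+1) in let y' := dsubmx (z k.+1) in
    prox f s (x - s *: (A^T *m y)) x' /\
    prox g s (y + s *: (A *m (2 *: x' - x))) y'.

End pdhg.

(* Main.v *)
(* PDHG is a proximal point method for the monotone operator KKT in the metric
   of P := Pmx A s: w_(k+1) := P (z_k - z_(k+1)) lies in KKT z_(k+1), and its
   P^-1-norm is the P-norm of z_k - z_(k+1).  Monotonicity makes the distance of
   0 to KKT z_k nonincreasing, and makes the squared P-distance from z_k to a
   solution drop by at least |w_(k+1)|^2 at each step, so K steps bring the
   squared distance of 0 to KKT below 1/K times the squared P-distance of the
   starting point to the solution set.  By the sharpness hypothesis,
   K >= e / alpha^2 steps divide the former by e; iterate over blocks of length
   K. *)
Require Import Defs.
From mathcomp Require Import all_boot all_order all_algebra.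
From mathcomp Require Import all_classical all_reals all_analysis.
From mathcomp Require Import ring lra.

Set Implicit Arguments.
Unset Strict Implicit.
Unset Printing Implicit Defensive.

Import Order.TTheory GRing.Theory Num.Theory.
Import numFieldNormedType.Exports.

Local Open Scope classical_set_scope.
Local Open Scope ring_scope.

(** * Euclidean inner product and norm on column vectors *)

Section dotp.
Context {R : realType}.
Implicit Types n : nat.

Lemma dotpE n (u v : 'cV[R]_n) : dotp u v = \sum_i u i 0 * v i 0.
Proof. by rewrite /dotp mxE; apply: eq_bigr => i _; rewrite mxE. Qed.

Lemma dotpC n (u v : 'cV[R]_n) : dotp u v = dotp v u.
Proof. by rewrite !dotpE; apply: eq_bigr => i _; rewrite mulrC. Qed.

Lemma dotpDl n (u v w : 'cV[R]_n) : dotp (u + v) w = dotp u w + dotp v w.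
Proof. by rewrite /dotp linearD mulmxDl mxE. Qed.

Lemma dotpDr n (u v w : 'cV[R]_n) : dotp u (v + w) = dotp u v + dotp u w.
Proof. by rewrite /dotp mulmxDr mxE. Qed.

Lemma dotpNl n (u w : 'cV[R]_n) : dotp (- u) w = - dotp u w.
Proof. by rewrite /dotp linearN mulNmx mxE. Qed.

Lemma dotpNr n (u w : 'cV[R]_n) : dotp u (- w) = - dotp u w.
Proof. by rewrite /dotp mulmxN mxE. Qed.

Lemma dotpZl n a (u w : 'cV[R]_n) : dotp (a *: u) w = a * dotp u w.
Proof. by rewrite /dotp linearZ -scalemxAl mxE. Qed.

Lemma dotpZr n a (u w : 'cV[R]_n) : dotp u (a *: w) = a * dotp u w.
Proof. by rewrite /dotp -scalemxAr mxE. Qed.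

Definition dotp_lin := (dotpDl, dotpDr, dotpNl, dotpNr, dotpZl, dotpZr).

Lemma dotp0l n (u : 'cV[R]_n) : dotp 0 u = 0.
Proof. by rewrite /dotp trmx0 mul0mx mxE. Qed.

Lemma dotp0r n (u : 'cV[R]_n) : dotp u 0 = 0.
Proof. by rewrite dotpC dotp0l. Qed.

Lemma dotp_trmx m n (A : 'M[R]_(m, n)) u v : dotp u (A *m v) = dotp (A^T *m u) v.
Proof. by rewrite /dotp trmx_mul trmxK mulmxA. Qed.

Lemma dotp_col_mx n m (u u' : 'cV[R]_n) (v v' : 'cV[R]_m) :
  dotp (col_mx u v) (col_mx u' v') = dotp u u' + dotp v v'.
Proof. by rewrite /dotp tr_col_mx mul_row_col mxE. Qed.

Lemma dotp_ge0 n (u : 'cV[R]_n) : 0 <= dotp u u.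
Proof. by rewrite dotpE sumr_ge0 // => i _; rewrite -expr2 sqr_ge0. Qed.

Lemma dotp_eq0 n (u : 'cV[R]_n) : (dotp u u == 0) = (u == 0).
Proof.
apply/idP/eqP => [|->]; last by rewrite dotp0l.
rewrite dotpE psumr_eq0 => [/allP u0|i _]; last by rewrite -expr2 sqr_ge0.
apply/matrixP => i j; rewrite ord1 mxE; apply/eqP.
by have := u0 i (mem_index_enum _); rewrite -expr2 sqrf_eq0.
Qed.

Lemma dotp_gt0 n (u : 'cV[R]_n) : (0 < dotp u u) = (u != 0).
Proof. by rewrite lt_def dotp_ge0 andbT dotp_eq0. Qed.

Lemma norm2_sqr n (u : 'cV[R]_n) : norm2 u ^+ 2 = dotp u u.
Proof. by rewrite sqr_sqrtr // dotp_ge0. Qed.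

Lemma norm2Z n a (u : 'cV[R]_n) : norm2 (a *: u) = `|a| * norm2 u.
Proof. by rewrite /norm2 !dotp_lin mulrA -expr2 sqrtrM ?sqr_ge0// sqrtr_sqr. Qed.

Lemma norm2_ge0 n (u : 'cV[R]_n) : 0 <= norm2 u.
Proof. exact: sqrtr_ge0. Qed.

Lemma norm2_eq0 n (u : 'cV[R]_n) : (norm2 u == 0) = (u == 0).
Proof. by rewrite -dotp_eq0 -norm2_sqr sqrf_eq0. Qed.

Lemma norm20 n : norm2 (0 : 'cV[R]_n) = 0.
Proof. by apply/eqP; rewrite norm2_eq0. Qed.

Lemma normr_le_norm2 n (u : 'cV[R]_n) i : `|u i 0| <= norm2 u.
Proof.
rewrite -(ler_pXn2r (n := 2)) ?nnegrE ?norm2_ge0// norm2_sqr real_normK ?num_real//.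
rewrite dotpE (bigD1 i)//= -expr2 lerDl sumr_ge0// => j _.
by rewrite -expr2 sqr_ge0.
Qed.

End dotp.

(** * The operator norm as a Lipschitz constant *)

Section opnorm.
Context {R : realType} (m n : nat) (A : 'M[R]_(m, n)).

(** Needed for [sup] to be a genuine supremum. Entries of a vector in the unit ball are at most 1 in
    absolute value, so the absolute row sums of [A] bound its image. *)
Lemma opnorm_has_ubound :
  has_ubound [set norm2 (A *m x) | x in [set x : 'cV[R]_n | norm2 x <= 1]].
Proof.
exists (Num.sqrt (\sum_i (\sum_j `|A i j|) ^+ 2)) => _ [x x1 <-].
rewrite /norm2 ler_sqrt; last by rewrite sumr_ge0// => i _; rewrite sqr_ge0.
rewrite dotpE ler_sum// => i _; rewrite -expr2 -real_normK ?num_real//.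
rewrite ler_pXn2r ?nnegrE ?sumr_ge0// mxE (le_trans (ler_norm_sum _ _ _))//.
rewrite ler_sum// => j _; rewrite normrM ler_piMr//.
exact: le_trans (normr_le_norm2 _ _) x1.
Qed.

Lemma opnorm_ge0 : 0 <= opnorm A.
Proof.
apply: ub_le_sup; first exact: opnorm_has_ubound.
by exists 0; rewrite ?mulmx0 /= norm20.
Qed.

Lemma norm2_mulmx_le x : norm2 (A *m x) <= opnorm A * norm2 x.
Proof.
have [->|x0] := eqVneq x 0.
  by rewrite mulmx0 norm20 mulr_ge0 ?opnorm_ge0 ?norm2_ge0.
have nx : 0 < norm2 x by rewrite lt_def norm2_eq0 x0 norm2_ge0.
rewrite -ler_pdivrMr// mulrC -[(norm2 x)^-1]ger0_norm ?invr_ge0 ?norm2_ge0//.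
rewrite -norm2Z scalemxAr; apply: ub_le_sup; first exact: opnorm_has_ubound.
exists ((norm2 x)^-1 *: x) => //=.
by rewrite norm2Z ger0_norm ?invr_ge0 ?norm2_ge0// mulVf ?gt_eqF.
Qed.

End opnorm.

(** * Subdifferentials and proximal maps of proper functions *)

Section subdifferential.
Context {R : realType} (n : nat) (h : 'cV[R]_n -> \bar R).
Hypothesis h_proper : proper_fct h.

(** The value +oo at [x] would force +oo everywhere, against properness. *)
Lemma subdiff_fin x v : subdiff h x v -> h x \is a fin_num.
Proof.
have [hNy [x0 hx0]] := h_proper => /(_ x0) hxx0.
rewrite fin_numE hNy; apply/eqP => hx; move: hxx0.
by rewrite hx addye// leye_eq => /eqP hx0y; rewrite hx0y in hx0.
Qed.

(** Add the two subgradient inequalities, each tested at the other point; the function values are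
    finite and cancel. *)
Lemma subdiff_monotone x y u v :
  subdiff h x u -> subdiff h y v -> 0 <= dotp (u - v) (x - y).
Proof.
move=> hu hv; have := subdiff_fin hu; have := subdiff_fin hv.
move: (hu y) (hv x); case: (h x) => // a; case: (h y) => // b.
by rewrite -!EFinD !lee_fin !dotp_lin => ab ba _ _; lra.
Qed.

(* Compares the minimum of the proximal objective with its values on the
   segment from u to w, and lets the segment parameter tend to 0. *)
Lemma prox_subdiff tau x u : econvex h -> 0 < tau -> prox h tau x u ->
  subdiff h u (tau^-1 *: (x - u)).
Proof.
move=> hcvx tau0 umin w; have [hNy [x0 hx0]] := h_proper.
have hu : h u \is a fin_num.
  rewrite fin_numE hNy; apply/eqP => huy; have := umin x0.
  rewrite huy addye// leye_eq => /eqP; move: hx0 (hNy x0).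
  by case: (h x0).
move: (hNy w) (hcvx w u); have uw t := umin (t *: w + (1 - t) *: u).
case: (h w) => [b _||//]; last by rewrite leey.
move: hu uw => /fineK <-; set a := fine _ => uw hcvx'.
rewrite -EFinD lee_fin.
set c := (2 * tau)^-1 in uw; set N := c * dotp (w - u) (w - u).
have c0 : 0 < c by rewrite invr_gt0 mulr_gt0.
have N0 : 0 <= N by rewrite mulr_ge0 ?dotp_ge0// ltW.
have ctau : tau^-1 = 2 * c by rewrite /c; field; rewrite gt_eqF.
(* Minimality of [u] is combined with convexity at [t *: w + (1 - t) *: u]; the common square of
   [u - x] cancels, and after division by [t] only the second-order term [t * N] is left over. *)
have key t : 0 < t -> t <= 1 -> a + dotp (tau^-1 *: (x - u)) (w - u) <= b + t * N.
  move=> t0 t1; have := hcvx' t; rewrite ltW// t1 => /(_ isT); have := uw t.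
  case: (h _) (hNy (t *: w + (1 - t) *: u)) => // d _.
  rewrite -!EFinM -!EFinD !lee_fin !norm2_sqr => H1 H2.
  rewrite -(ler_pM2l t0) ctau; move: H1; rewrite /N.
  have -> : t *: w + (1 - t) *: u - x = (u - x) + t *: (w - u).
    by rewrite scalerBl scale1r scalerBr; apply/matrixP => i j; rewrite !mxE; ring.
  have -> : x - u = - (u - x) by rewrite opprB.
  rewrite !(dotpDl _ (t *: _)) !(dotpDr _ _ (t *: _)) !(dotpZl, dotpZr, dotpNl).
  rewrite (dotpC (w - u) (u - x)) => H1.
  by nra.
rewrite leNgt; apply/negP; set l := dotp _ _ in key *; rewrite -subr_gt0.
set G := _ - b => G0.
have GN : 0 < G + N by rewrite ltr_wpDr.
(* An explicit parameter replaces the limit: for a positive gap [G] this [t] satisfies [t * N < G],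
   against [key]. *)
have := key (G / (G + N)); rewrite divr_gt0// ler_pdivrMr// mul1r lerDl.
move=> /(_ isT N0); apply/negP; rewrite -ltNge -ltrBrDl -/G.
by rewrite mulrAC ltr_pdivrMr// ltr_pM2l// ltrDr.
Qed.

End subdifferential.

(** * Bounds on the distance to a set *)

Section distM.
Context {R : realType} (p : nat) (M : 'M[R]_p).
Implicit Types (z : 'cV[R]_p) (S : set 'cV[R]_p).
Local Open Scope ereal_scope.

Lemma distM_ge0 z S : 0 <= distM M z S.
Proof. by apply: le_ereal_inf_tmp => _ [u _ <-]; rewrite lee_fin sqrtr_ge0. Qed.

Lemma distM_le z S u : S u -> distM M z S <= (normM M (u - z))%:E.
Proof. by move=> Su; apply: ereal_inf_lbound; exists u. Qed.

Lemma le_distM z S (d : \bar R) :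
  (forall u, S u -> d <= (normM M (u - z))%:E) -> d <= distM M z S.
Proof. by move=> dS; apply: le_ereal_inf_tmp => _ [u Su <-]; apply: dS. Qed.

End distM.

(** * Proximal point method for a monotone operator in the metric of [M] *)

Section proximal_point.
Context {R : realType} (p : nat) (M : 'M[R]_p) (T : 'cV[R]_p -> set 'cV[R]_p).
Hypothesis M_sym : M^T = M.
Hypothesis M_pos : forall u, u != 0 -> 0 < dotp u (M *m u).
Hypothesis T_mono :
  forall x y u v, T x u -> T y v -> 0 <= dotp (u - v) (x - y).
Variable z : nat -> 'cV[R]_p.
Hypothesis z_step : forall k, T (z k.+1) (M *m (z k - z k.+1)).

Let q u := dotp u (M *m u).
Let d k := z k - z k.+1.

Let q_ge0 u : 0 <= q u.
Proof.
by have [->|/M_pos/ltW//] := eqVneq u 0; rewrite /q mulmx0 dotp0r.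
Qed.

Let qC u v : dotp (M *m u) v = dotp (M *m v) u.
Proof. by rewrite [RHS]dotpC dotp_trmx M_sym. Qed.

Let qE u : q u = dotp (M *m u) u. Proof. exact: dotpC. Qed.

(** A nonzero row [r] of the left kernel would give r M r^T = 0, against positivity. *)
Lemma posdef_unitmx : M \in unitmx.
Proof.
rewrite -row_free_unit -kermx_eq0; apply/eqP/row_matrixP => i.
rewrite row0; apply/eqP; apply: contraTT isT => /eqP.
set r := row i _ => r0.
have rM : r *m M = 0 by rewrite /r -row_mul mulmx_ker row0.
have /M_pos : r^T != 0 by rewrite -(trmx0 _ 1 p) (inj_eq trmx_inj); apply/eqP.
by rewrite /dotp trmxK mulmxA rM mul0mx mxE ltxx.
Qed.

Lemma invmx_dotp u : dotp (M *m u) (invmx M *m (M *m u)) = q u.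
Proof. by rewrite mulmxA mulVmx ?posdef_unitmx// mul1mx -qE. Qed.

Lemma normM_invmx u : normM (invmx M) (M *m u) = normM M u.
Proof. by rewrite /normM invmx_dotp. Qed.

(** Write w = M v. Monotonicity between [z k] and [z k.+1] gives q(d) <= <M v, d>, and expanding 0
    <= q(v - d) turns this into q(d) <= q(v). *)
Lemma ppa_step_le k w : T (z k) w -> normM M (d k) <= normM (invmx M) w.
Proof.
move=> Tw; rewrite -[w](mulKVmx posdef_unitmx) normM_invmx.
set v := invmx M *m w; rewrite /normM ler_sqrt; last exact: q_ge0.
have := T_mono (z_step k) Tw; rewrite -[w](mulKVmx posdef_unitmx) -/v -/(d k).
have -> : z k.+1 - z k = - d k by rewrite opprB.
have := q_ge0 (v - d k).
move: (d k) v => e v; rewrite -/(q e) -/(q v) !qE mulmxBr !dotp_lin (qC e v).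
lra.
Qed.

(** In the expansion of q(d + (z_(k+1) - zs)), the cross term is nonnegative by monotonicity, since
    0 lies in [T zs]. *)
Lemma ppa_fejer k zs : T zs 0 -> q (z k.+1 - zs) + q (d k) <= q (z k - zs).
Proof.
move=> Tzs; have := T_mono (z_step k) Tzs; rewrite subr0 -/(d k).
have -> : z k - zs = d k + (z k.+1 - zs) by rewrite /d addrA subrK.
move: (d k) (z k.+1 - zs) => e e'.
by rewrite !qE mulmxDr !dotp_lin (qC e' e) => H; lra.
Qed.

(** [M *m d k] is itself an element of [T (z k.+1)], so [ppa_step_le] applies to it. *)
Lemma ppa_step_noninc k : q (d k.+1) <= q (d k).
Proof.
have := ppa_step_le (z_step k); rewrite normM_invmx /normM ler_sqrt//.
exact: q_ge0.
Qed.

(** Telescopes [ppa_fejer] over K + 1 steps, each drop being at least the last one,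
    [q (d (k + K))]. *)
Lemma ppa_sum k K zs : T zs 0 ->
  K.+1%:R * q (d (k + K)) + q (z (k + K).+1 - zs) <= q (z k - zs).
Proof.
move=> Tzs; elim: K => [|K IH].
  by rewrite mul1r addn0 addrC; exact: ppa_fejer.
have := ppa_fejer (k + K).+1 Tzs; have := ppa_step_noninc (k + K).
rewrite addnS; move: IH; rewrite -natr1 -[K.+2%:R]natr1 -natr1.
by have := ler0n R K; move: (K%:R) => a; nra.
Qed.

Local Open Scope ereal_scope.

(** Any element of [T (z l)] is at least as long as the next displacement, which has the same length
    as an element of [T (z l.+1)]. An empty [T (z l)] has distance +oo. *)
Lemma ppa_distM_noninc k l : (k <= l)%N ->
  distM (invmx M) 0%R (T (z l)) <= distM (invmx M) 0%R (T (z k)).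
Proof.
elim: l => [|l IH]; first by rewrite leqn0 => /eqP ->.
rewrite leq_eqVlt => /predU1P[->//|/IH]; apply: le_trans.
apply: le_distM => w /ppa_step_le; rewrite subr0 => Tw.
apply: le_trans (distM_le _ _ (z_step l)) _.
by rewrite subr0 normM_invmx lee_fin.
Qed.

Lemma ppa_distM_sublinear k K : (0 < K)%N ->
  (Num.sqrt K%:R)%:E * distM (invmx M) 0%R (T (z (k + K)))
    <= distM M (z k) [set zs | T zs 0%R].
Proof.
case: K => // K _; apply: le_distM => zs Tzs.
(* Here [K] is the predecessor of the step count: the residual at [z (k + K).+1] comes from the
   displacement [d (k + K)]. *)
rewrite addnS; apply: (@le_trans _ _ ((Num.sqrt K.+1%:R)%:E * (normM M (d (k + K)))%:E)).
  rewrite lee_wpmul2l ?lee_fin ?sqrtr_ge0//.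
  by rewrite -normM_invmx -[X in normM _ X]subr0; exact: distM_le (z_step _).
rewrite -EFinM lee_fin -sqrtrM ?ler0n// ler_sqrt; last exact: q_ge0.
rewrite -[(zs - z k)%R]opprB mulmxN dotpNl dotpNr opprK.
by apply: le_trans (ppa_sum k K Tzs); rewrite lerDl q_ge0.
Qed.

Lemma ppa_distM_linear (alpha : R) K : (0 < alpha)%R -> (0 < K)%N ->
  (expR 1 <= K%:R * alpha ^+ 2)%R ->
  (forall k, alpha%:E * distM M (z k) [set zs | T zs 0%R]
               <= distM (invmx M) 0%R (T (z k))) ->
  forall k, distM (invmx M) 0%R (T (z k)) ^+ 2
    <= (expR (1 - k%:R / K%:R))%:E * distM (invmx M) 0%R (T (z 0%N)) ^+ 2.
Proof.
move=> a0 K0 eK sharp.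
set D := fun k => distM (invmx M) 0%R (T (z k)).
have D0 k : 0 <= D k by exact: distM_ge0.
have contract k : D (k + K)%N ^+ 2 <= (expR (- 1))%:E * D k ^+ 2.
  rewrite expRN lee_pdivlMl ?expR_gt0//.
  apply: (@le_trans _ _ ((K%:R * alpha ^+ 2)%:E * D (k + K)%N ^+ 2)).
    by rewrite lee_wpmul2r ?lee_fin// expe_ge0.
  have -> : (K%:R * alpha ^+ 2)%:E * D (k + K)%N ^+ 2 =
      (alpha%:E * ((Num.sqrt K%:R)%:E * D (k + K)%N)) ^+ 2.
    rewrite -[K%:R in LHS]sqr_sqrtr ?ler0n// mulrC EFinM !EFin_expe !expe2.
    by rewrite -[LHS]muleA [RHS]muleACA; congr (_ * _); rewrite muleACA.
  have le : alpha%:E * ((Num.sqrt K%:R)%:E * D (k + K)%N) <= D k.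
    apply: le_trans (sharp k); apply: lee_wpmul2l; last exact: ppa_distM_sublinear.
    by rewrite lee_fin ltW.
  by rewrite lee_sqr// !mule_ge0 ?lee_fin ?sqrtr_ge0// ltW.
have iterate j r : D (j * K + r)%N ^+ 2 <= (expR (- j%:R))%:E * D r ^+ 2.
  elim: j => [|j IH]; first by rewrite mul0n add0n oppr0 expR0 mul1e.
  rewrite mulSn -addnA addnC; apply: le_trans (contract _) _.
  rewrite -natr1 opprD addrC expRD EFinM -muleA lee_wpmul2l// lee_fin expR_ge0.
(* The k %/ K full blocks give exp(-(k %/ K)); rounding down costs at most a factor e, whence the 1
   in the exponent. The remainder only uses that [D] is nonincreasing. *)
move=> k; rewrite -!/(D _) {1}(divn_eq k K).
apply: le_trans (iterate _ _) _; apply: lee_pmul.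
- by rewrite lee_fin expR_ge0.
- by rewrite expe_ge0.
- rewrite lee_fin ler_expR.
  have : (k%:R / K%:R <= (k %/ K)%:R + 1 :> R)%R.
    rewrite ler_pdivrMr ?ltr0n// natr1 -natrM ler_nat ltnW//.
    exact: ltn_ceil.
  lra.
- by rewrite lee_sqr//; exact: ppa_distM_noninc.
Qed.

End proximal_point.

(** * PDHG as a proximal point method *)

Section pdhg.
Context {R : realType} (n m : nat).
Variables (f : 'cV[R]_n -> \bar R) (g : 'cV[R]_m -> \bar R) (A : 'M[R]_(m, n)).

(** The bilinear coupling is skew: its two contributions to the inner product cancel, leaving the
    subdifferentials of [f] and [g]. *)
Lemma KKT_monotone : proper_fct f -> proper_fct g ->
  forall z w u v, KKT f g A z u -> KKT f g A w v -> 0 <= dotp (u - v) (z - w).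
Proof.
move=> pf pg z w _ _ [u1 [v1 [fu1 gv1 ->]]] [u2 [v2 [fu2 gv2 ->]]].
have := subdiff_monotone pf fu1 fu2; have := subdiff_monotone pg gv1 gv2.
have -> : z - w = col_mx (usubmx z - usubmx w) (dsubmx z - dsubmx w).
  by rewrite -add_col_mx -opp_col_mx !vsubmxK.
move: (usubmx z) (dsubmx z) (usubmx w) (dsubmx w) => x1 y1 x2 y2.
rewrite opp_col_mx add_col_mx dotp_col_mx.
have -> : u1 + A^T *m y1 - (u2 + A^T *m y2) = (u1 - u2) + A^T *m (y1 - y2).
  by rewrite mulmxBr opprD addrACA.
have -> : - (A *m x1) + v1 - (- (A *m x2) + v2) = (v1 - v2) - A *m (x1 - x2).
  by rewrite mulmxBr opprD addrACA addrC opprK opprB [- _ + _]addrC.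
rewrite !(dotpDl _ (A^T *m _)) (dotpDl _ (- (A *m _))) dotpNl -dotp_trmx.
by rewrite (dotpC (y1 - y2)) => H1 H2; lra.
Qed.

Lemma Pmx_sym s : (Pmx A s)^T = Pmx A s.
Proof. by rewrite /Pmx tr_block_mx !tr_scalar_mx !linearN /= trmxK. Qed.

(** s times the form is |s A x - y|^2 + |x|^2 - |s A x|^2, and |s A x| <= s L |x| < |x| unless x =
    0, where it reduces to |y|^2. *)
Lemma Pmx_dotp_gt0 s : 0 < s -> (s%:E < (opnorm A)%:E^-1)%E ->
  forall u, u != 0 -> 0 < dotp u (Pmx A s *m u).
Proof.
move=> s0 sA u u0; set L := opnorm A in sA.
have L0 : 0 <= L := opnorm_ge0 A.
have sL : s * L < 1.
  (* The extended inverse of 0 is +oo, so L = 0 is treated apart. *)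
  move: sA; rewrite inver; case: ifPn => [/eqP ->|L1]; first by rewrite mulr0.
  by rewrite lte_fin -ltr_pdivlMr ?div1r// lt_def L1.
move: u0; rewrite -[u]vsubmxK; move: (usubmx u) (dsubmx u) => x y u0.
rewrite /Pmx mul_block_col !mul_scalar_mx dotp_col_mx !mulNmx !dotp_lin.
rewrite (dotp_trmx A^T) trmxK (dotpC y).
have AxL : dotp (A *m x) (A *m x) <= L ^+ 2 * dotp x x.
  rewrite -!norm2_sqr -exprMn ler_pXn2r ?nnegrE ?norm2_mulmx_le//.
  - exact: norm2_ge0.
  - by rewrite mulr_ge0 ?norm2_ge0.
rewrite -(pmulr_rgt0 _ s0) !mulrDr !mulrA divff ?gt_eqF// !mul1r.
have [x0|x0] := eqVneq x 0.
  have y0 : y != 0 by apply: contraNneq u0 => ->; rewrite x0 col_mx0.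
  by move: y0; rewrite x0 mulmx0 !dotp0l -dotp_gt0 oppr0 mulr0 !add0r.
have := dotp_ge0 (s *: (A *m x) - y); rewrite !dotp_lin (dotpC y).
have : (s * L) ^+ 2 * dotp x x < dotp x x.
  by rewrite gtr_pMl ?dotp_gt0// expr_lt1// mulr_ge0// ltW.
have : s ^+ 2 * dotp (A *m x) (A *m x) <= (s * L) ^+ 2 * dotp x x.
  by rewrite exprMn -[leRHS]mulrA ler_pM2l ?exprn_gt0.
by lra.
Qed.

(** The proximal steps supply the two subgradients. The extrapolation 2 x' - x turns the second row
    into (y - y') / s - A (x - x'), which is what makes the metric symmetric. *)
Lemma PDHG_step : proper_fct f -> econvex f -> proper_fct g -> econvex g ->
  forall s z, 0 < s -> is_PDHG f g A s z ->
  forall k, KKT f g A (z k.+1) (Pmx A s *m (z k - z k.+1)).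
Proof.
move=> pf cf pg cg s z s0 zP k; have [] := zP k.
move=> /(prox_subdiff pf cf s0) fu /(prox_subdiff pg cg s0) gv.
do 2!eexists; split; [exact: fu|exact: gv|].
rewrite -{1}[z k]vsubmxK -{1}[z k.+1]vsubmxK opp_col_mx add_col_mx.
move: (usubmx (z k)) (dsubmx (z k)) (usubmx (z k.+1)) (dsubmx (z k.+1)).
move=> x y x' y'.
rewrite /Pmx mul_block_col !mul_scalar_mx !mulNmx !mulmxBr -!scalemxAr.
have sneq0 : s != 0 by rewrite gt_eqF.
congr col_mx; apply/matrixP => i j.
  by move: (A^T *m y) (A^T *m y') => a a'; rewrite !mxE; field.
by move: (A *m x) (A *m x') => a a'; rewrite !mxE; field.
Qed.

End pdhg.

Theorem theorem2 (R : realType) (n m : nat)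
    (f : 'cV[R]_n -> \bar R) (g : 'cV[R]_m -> \bar R) (A : 'M[R]_(m, n))
    (f_proper : proper_fct f) (f_lsc : lower_semicontinuous f) (f_convex : econvex f)
    (g_proper : proper_fct g) (g_lsc : lower_semicontinuous g) (g_convex : econvex g)
    (Zstar_neq0 : Zstar f g A !=set0)
    (s : R) (s_gt0 : 0 < s) (s_lt : (s%:E < (opnorm A)%:E^-1)%E)
    (z : nat -> 'cV[R]_(n + m)) (z_pdhg : is_PDHG f g A s z)
    (alpha : R) (alpha_gt0 : 0 < alpha)
    (S : set 'cV[R]_(n + m)) (zS : forall k : nat, S (z k))
    (sharp : forall w : 'cV[R]_(n + m), S w ->
       (alpha%:E * distM (Pmx A s) w (Zstar f g A)
          <= distM (invmx (Pmx A s)) 0%R (KKT f g A w))%E) :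
  forall k : nat, Num.ceil (expR 1 / alpha ^+ 2) <= k%:Z ->
    (distM (invmx (Pmx A s)) 0%R (KKT f g A (z k)) ^+ 2
       <= (expR (1 - k%:R / (Num.ceil (expR 1 / alpha ^+ 2))%:~R))%:E
          * distM (invmx (Pmx A s)) 0%R (KKT f g A (z 0%N)) ^+ 2)%E.
Proof.
move=> k _; have c0 : 0 < expR 1 / alpha ^+ 2 by rewrite divr_gt0 ?expR_gt0 ?exprn_gt0.
have := ceil_ge (expR 1 / alpha ^+ 2); have := c0; rewrite -ceil_gt0.
(* Positivity of the ceiling excludes negative integers and yields the block length as a natural
   number. *)
case: (Num.ceil _) => // K; rewrite ltz_nat -pmulrn => K0.
rewrite ler_pdivrMr ?exprn_gt0// => eK.
apply: (ppa_distM_linear (Pmx_sym A s) (Pmx_dotp_gt0 s_gt0 s_lt)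
  (KKT_monotone f_proper g_proper) (PDHG_step _ _ _ _ _ _) alpha_gt0) => // j.
exact: sharp.
Qed.
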